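(* Let $1<p<\infty$ with $p\ge d$. Suppose $Q\colon\mathbb R^{d\times d}\to\mathbb R$ is a positive semidefinite quadratic form which is positive definite on the symmetric $d\times d$ matrices and vanishes on antisymmetric matrices. Then there exists $W_{\rm cell}\colon\mathbb R^{d\times2^d}\to[0,\infty)$ such that (a) for some constants $c,c',c''>0$, $c|F|^p-c'\le W_{\rm cell}(F)\le c''(|F|^p+1)$ for every $F\in V_0$; (b) $W_{\rm cell}(RF+(b,\dots,b))=W_{\rm cell}(F)$ for all $F\in\mathbb R^{d\times2^d}$, $R\in SO(d)$, $b\in\mathbb R^d$; (c) $W_{\rm cell}(F)$ is minimal ($=0$) if and only if there exist $R\in SO(d)$ and $b\in\mathbb R^d$ such that $F=RZ+(b,\dots,b)$; (d) $W_{\rm cell}$ is $C^2$ in a neighborhood of $SO(d)Z$ and the Hessian $D^2W_{\rm cell}(Z)$ is positive definite on the orthogonal complement of the subspace spanned by translations $(b,\dots,b)$, $b\in\mathbb R^d$, and infinitesimal rotations $BZ$ with $B\in\mathbb R^{d\times d}$, $B^T=-B$; and such that, with $W_{\rm CB}(M):=\frac1{|\det A|}W_{\rm cell}(MZ)$ for $M\in\mathbb R^{d\times d}$, $$\tfrac12D^2W_{\rm CB}(\mathrm{Id})(M,M)=Q(M)\qquad\text{for all }M\in\mathbb R^{d\times d}.$$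
   Context: $d\in\mathbb N$; $A\in\mathbb R^{d\times d}$ is a fixed invertible matrix; $z_1,\dots,z_{2^d}$ are the points of $A\{-\frac12,\frac12\}^d$ and $Z=(z_1,\dots,z_{2^d})\in\mathbb R^{d\times2^d}$. $V_0=\{F=(a_{ij})\in\mathbb R^{d\times2^d}:\sum_{j=1}^{2^d}a_{ij}=0\ \text{for } i=1,\dots,d\}$. $\mathrm{Id}$ is the $d\times d$ identity matrix. *)

(* Defs.v *)
From HB Require Import structures.
From mathcomp Require Import all_boot all_order all_algebra.
From mathcomp Require Import sesquilinear.
From mathcomp Require Import all_classical all_reals all_analysis.
Set Implicit Arguments.
Unset Strict Implicit.
Unset Printing Implicit Defensive.
Import Order.TTheory GRing.Theory Num.Theory.
Import numFieldNormedType.Exports.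
Local Open Scope classical_set_scope.
Local Open Scope ring_scope.

(* The library norm on matrices is the sup norm of the entries; the Euclidean
   structure is therefore introduced here. *)
Definition mx_inner (R : realType) (m n : nat) (F G : 'M[R]_(m, n)) : R :=
  \sum_i \sum_j F i j * G i j.

Definition mx_enorm (R : realType) (m n : nat) (F : 'M[R]_(m, n)) : R :=
  Num.sqrt (mx_inner F F).

Definition SO (R : realType) (d : nat) : set 'M[R]_d :=
  [set P | P^T *m P = 1%:M /\ \det P = 1].

Definition antisymmetric_mx (R : realType) (d : nat) (B : 'M[R]_d) : Prop :=
  B^T = - B.

(* (b, ..., b) *)
Definition translation_mx (R : realType) (d n : nat) (b : 'cV[R]_d)
  : 'M[R]_(d, n) := \matrix_(i, j) b i 0.

(* The columns of Z enumerate, in an arbitrary order and without repetition,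
   the points of A {-1/2, 1/2}^d. *)
Definition enumerates_cell (R : realType) (d : nat) (A : 'M[R]_d)
    (Z : 'M[R]_(d, 2 ^ d)) : Prop :=
  injective (fun j => col j Z) /\
  range (fun j => col j Z) =
    [set A *m e | e in [set e : 'cV[R]_d |
                          forall i, e i 0 = - 2^-1 \/ e i 0 = 2^-1]].

Definition V0 (R : realType) (d : nat) : set 'M[R]_(d, 2 ^ d) :=
  [set F | forall i, \sum_j F i j = 0].

(* Already closed under linear combinations, hence the whole subspace spanned
   by translations and infinitesimal rotations at Z. *)
Definition infinitesimal_rigid_motions (R : realType) (d n : nat)
    (Z : 'M[R]_(d, n)) : set 'M[R]_(d, n) :=
  [set G | exists (b : 'cV[R]_d) (B : 'M[R]_d),
     antisymmetric_mx B /\ G = translation_mx n b + B *m Z].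

Definition orthogonal_complement (R : realType) (m n : nat)
    (S : set 'M[R]_(m, n)) : set 'M[R]_(m, n) :=
  [set F | forall G, S G -> mx_inner F G = 0].

Definition is_quadratic_form (R : realType) (m n : nat)
    (Q : 'M[R]_(m, n) -> R) : Prop :=
  exists B : {symmetric 'M[R]_(m, n)}, forall M, Q M = B M M.

(* Continuity of the first derivatives follows from their differentiability. *)
Definition C2_on (R : realType) (V : normedModType R) (U : set V) (f : V -> R)
  : Prop :=
  forall x, U x ->
    [/\ differentiable f x,
        forall v, differentiable ('D_v f) x &
        forall v w, {for x, continuous ('D_w ('D_v f))}].

(* Meaningful only near points where f is C^2, as 'D_v is a total operator. *)
Definition hessian (R : realType) (V : normedModType R) (f : V -> R) (x v w : V)
  : R := 'D_v ('D_w f) x.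

Definition W_CB (R : realType) (d : nat) (A : 'M[R]_d) (Z : 'M[R]_(d, 2 ^ d))
    (W : 'M[R]_(d, 2 ^ d) -> R) (M : 'M[R]_d) : R :=
  `|\det A|^-1 * W (M *m Z).

(* Main.v *)
Require Import Defs.
From HB Require Import structures.
From mathcomp Require Import all_boot all_order all_algebra.
From mathcomp Require Import sesquilinear.
From mathcomp Require Import all_classical all_reals all_analysis.
From mathcomp Require Import ring lra.
Import Order.TTheory GRing.Theory Num.Theory.
Import numFieldNormedType.Exports.
Local Open Scope classical_set_scope.
Local Open Scope ring_scope.

(** The energy is built from a polynomial and a cut-off. A deformation F of the
    cell splits as F = M Z + N + (b, ..., b), where M = F Y is its affine part
    (Y a right inverse of Z killing translations) and N = F T, with
    T = C - Y Z and C the subtraction of the mean column, is what is neither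
    affine nor a translation. The polynomial
      E(F) = |det A| / 4 * Q(M^T M - 1) + |N|^2
    is nonnegative and invariant under F |-> R F + (b, ..., b). As Q is positive
    definite on symmetric matrices, it vanishes exactly when M is orthogonal and
    N = 0. On the open, invariant set
      U = { det M > 0, |F C|^2 < |Z|^2 + 1, E(F) < 1 },
    which contains SO(d) Z, put W = E; elsewhere put W = 1 + |F C|^p. The
    determinant condition removes the zeros with det M = -1, the bound on |F C|
    makes c |F|^p - c' negative on U, and E < 1 gives the upper bound there, so
    (a), (b) and (c) are immediate and W is smooth on U.

    Second derivatives are read off on lines through Z: with M = H Y,
      E(Z + t H) = t^2 (|det A| / 4 * Q(M + M^T) + |H T|^2) + O(t^3).
    Since Q is nonnegative and vanishes on antisymmetric matrices, these lie in
    its kernel, so Q(M + M^T) = 4 Q(M) (quadratic_form_sym). For H = M Z this is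
    the identity for the Hessian of W_CB. If the t^2 coefficient vanishes then M
    is antisymmetric and H T = 0, so H is an infinitesimal rigid motion; this is
    (d). The smoothness needed is that of polynomials in the entries, a class
    closed under directional derivatives (polyfun_derive). *)

(** * Functions agreeing locally *)

(** The first-order expansion only sees f near x, and it determines the
    differential, so f and g have the same one. *)
Lemma near_eq_differentiable {R : realType} {V W : normedModType R}
    (f g : V -> W) (x : V) :
  (\near x, f x = g x) -> differentiable f x -> differentiable g x.
Proof.
move=> fg df.
have fgx : f x = g x := nbhs_singleton fg.
have expand : g \o shift x = cst (g x) + 'd f x +o_ 0 id.
  have /eqaddoP := diff_locally df; rewrite fgx => H.
  apply/eqaddoP => e e0; have := H e e0.
  move: fg; rewrite (near_shift 0) /= => fg.
  apply: filterS2 fg => h /=; rewrite subr0 => fgh; rewrite !fctE /= fgh; exact.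
have dfc : continuous ('d f x) by exact: diff_continuous.
have dgE : 'd g x = 'd f x :> (V -> W) by exact: diff_unique.
by apply/diff_locallyP; rewrite dgE.
Qed.

Lemma near_eq_continuous {V W : topologicalType} (f g : V -> W) (x : V) :
  (\near x, f x = g x) -> {for x, continuous f} -> {for x, continuous g}.
Proof.
move=> fg fx; rewrite /prop_for /continuous_at -(nbhs_singleton fg).
by apply: cvg_trans fx; exact: near_eq_cvg.
Qed.

(** * Polynomials in the entries of a matrix *)

Section PolynomialFunctions.
Set Implicit Arguments.
Unset Strict Implicit.
Context {R : realType} {m n : nat}.
Local Notation V := 'M[R]_(m, n).

(** An inductive class rather than multivariate polynomials: the product rule
    shows by induction that it is stable under directional derivatives, and
    this alone yields derivatives of every order. *)
Inductive polyfun : (V -> R) -> Prop :=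
| polyfun_cst c : polyfun (fun=> c)
| polyfun_coord i j : polyfun (fun F => F i j)
| polyfunD f g : polyfun f -> polyfun g -> polyfun (fun F => f F + g F)
| polyfunM f g : polyfun f -> polyfun g -> polyfun (fun F => f F * g F).

Lemma differentiable_polyfun f : polyfun f -> forall x, differentiable f x.
Proof.
elim=> [c|i j|{}f g _ ihf _ ihg|{}f g _ ihf _ ihg] x.
- exact: differentiable_cst.
- exact: differentiable_coord.
- exact: differentiableD.
- exact: differentiableM.
Qed.

Lemma derive_coord (i : 'I_m) (j : 'I_n) (x v : V) :
  'D_v (fun F : V => F i j) x = v i j.
Proof.
rewrite /derive; apply/lim_near_cst => //; near=> h.
rewrite /= !mxE addrK [LHS]mulrA mulVf ?mul1r//.
by near: h; exact: nbhs_dnbhs_neq.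
Unshelve. all: by end_near. Qed.

Lemma polyfun_derive f v : polyfun f -> polyfun ('D_v f).
Proof.
elim=> [c|i j|{}f g pf ihf pg ihg|{}f g pf ihf pg ihg].
- have -> : 'D_v (fun=> c) = (fun=> 0) :> (V -> R).
    by apply/funext => x; exact: derive_cst.
  exact: polyfun_cst.
- have -> : 'D_v (fun F : V => F i j) = (fun=> v i j) :> (V -> R).
    by apply/funext => x; exact: derive_coord.
  exact: polyfun_cst.
- have -> : 'D_v (fun F => f F + g F) = (fun x => 'D_v f x + 'D_v g x).
    apply/funext => x; apply: deriveD;
      exact/diff_derivable/differentiable_polyfun.
  exact: polyfunD.
- have -> : 'D_v (fun F => f F * g F) =
      (fun x => f x * 'D_v g x + g x * 'D_v f x).
    apply/funext => x; apply: deriveM;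
      exact/diff_derivable/differentiable_polyfun.
  by apply: polyfunD; apply: polyfunM.
Qed.

Lemma continuous_polyfun f : polyfun f -> continuous f.
Proof.
by move=> pf x; apply: differentiable_continuous; exact: differentiable_polyfun.
Qed.

Lemma polyfun_sum (I : Type) (s : seq I) (P : pred I) (f : I -> V -> R) :
  (forall i, polyfun (f i)) -> polyfun (fun F => \sum_(i <- s | P i) f i F).
Proof.
move=> pf; elim: s => [|i s ih].
  under eq_fun do rewrite big_nil; exact: polyfun_cst.
under eq_fun do rewrite big_cons.
by case: (P i) => //; exact: polyfunD.
Qed.

Lemma polyfun_prod (I : Type) (s : seq I) (P : pred I) (f : I -> V -> R) :
  (forall i, polyfun (f i)) -> polyfun (fun F => \prod_(i <- s | P i) f i F).
Proof.
move=> pf; elim: s => [|i s ih].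
  under eq_fun do rewrite big_nil; exact: polyfun_cst.
under eq_fun do rewrite big_cons.
by case: (P i) => //; exact: polyfunM.
Qed.

Definition polyfun_mx r s (Phi : V -> 'M[R]_(r, s)) :=
  forall i j, polyfun (fun F => Phi F i j).

Lemma polyfun_mx_id : polyfun_mx id.
Proof. by move=> i j; exact: polyfun_coord. Qed.

Lemma polyfun_mx_cst r s (M : 'M[R]_(r, s)) : polyfun_mx (fun=> M).
Proof. by move=> i j; exact: polyfun_cst. Qed.

Lemma polyfun_mxB r s (Phi Psi : V -> 'M[R]_(r, s)) :
  polyfun_mx Phi -> polyfun_mx Psi -> polyfun_mx (fun F => Phi F - Psi F).
Proof.
move=> pPhi pPsi i j; under eq_fun do rewrite !mxE -mulN1r.
by apply: polyfunD => //; apply: polyfunM => //; exact: polyfun_cst.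
Qed.

Lemma polyfun_mulmx r s t (Phi : V -> 'M[R]_(r, s)) (Psi : V -> 'M[R]_(s, t)) :
  polyfun_mx Phi -> polyfun_mx Psi -> polyfun_mx (fun F => Phi F *m Psi F).
Proof.
move=> pPhi pPsi i j; under eq_fun do rewrite mxE.
by apply: polyfun_sum => k; exact: polyfunM.
Qed.

Lemma polyfun_trmx r s (Phi : V -> 'M[R]_(r, s)) :
  polyfun_mx Phi -> polyfun_mx (fun F => (Phi F)^T).
Proof. by move=> pPhi i j; under eq_fun do rewrite mxE. Qed.

Lemma polyfun_det r (Phi : V -> 'M[R]_r) :
  polyfun_mx Phi -> polyfun (fun F => \det (Phi F)).
Proof.
move=> pPhi; apply: polyfun_sum => s; apply: polyfunM; first exact: polyfun_cst.
exact: polyfun_prod.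
Qed.

Lemma polyfun_inner r s (Phi Psi : V -> 'M[R]_(r, s)) :
  polyfun_mx Phi -> polyfun_mx Psi ->
  polyfun (fun F => mx_inner (Phi F) (Psi F)).
Proof.
move=> pPhi pPsi; apply: polyfun_sum => i; apply: polyfun_sum => j.
exact: polyfunM.
Qed.

(** Expanding the bilinear form on elementary matrices makes Q a polynomial in
    the entries of its argument. *)
Lemma polyfun_quadratic r s (Q : 'M[R]_(r, s) -> R) (Phi : V -> 'M[R]_(r, s)) :
  is_quadratic_form Q -> polyfun_mx Phi -> polyfun (fun F => Q (Phi F)).
Proof.
move=> [B QB] pPhi.
have BE M N : B M N = \sum_i \sum_j \sum_k \sum_l
    (M i j * N k l) * B (delta_mx i j) (delta_mx k l).
  rewrite {1}(matrix_sum_delta M) linear_sumlz.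
  apply: eq_bigr => i _; rewrite linear_sumlz; apply: eq_bigr => j _.
  rewrite {1}(matrix_sum_delta N) raddf_sum /=.
  apply: eq_bigr => k _; rewrite raddf_sum /=; apply: eq_bigr => l _.
  by rewrite linearZl_LR linearZr_LR /= mulrA.
under eq_fun do rewrite QB BE.
do 4 (apply: polyfun_sum => ?).
apply: polyfunM; last exact: polyfun_cst.
exact: polyfunM.
Qed.

(** The second derivatives of f are again polynomials, hence continuous; on an
    open set, local agreement transfers derivatives from f to W. *)
Lemma C2_polyfun U f W : polyfun f -> open U -> {in U, f =1 W} -> C2_on U W.
Proof.
move=> pf oU fW x Ux.
have near_ext (g h : V -> R) y : U y -> {in U, g =1 h} -> \near y, g y = h y.
  move=> Uy gh; have := open_nbhs_nbhs (conj oU Uy).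
  by apply: filterS => z Uz; apply: gh; rewrite inE.
have derive_ext v (g h : V -> R) : {in U, g =1 h} -> {in U, 'D_v g =1 'D_v h}.
  move=> gh y; rewrite inE => Uy; apply: near_eq_derive; exact: near_ext.
have diff_ext (g h : V -> R) : polyfun g -> {in U, g =1 h} -> differentiable h x.
  move=> pg gh; have := differentiable_polyfun pg x.
  by apply: near_eq_differentiable; exact: near_ext.
have cont_ext (g h : V -> R) :
    polyfun g -> {in U, g =1 h} -> {for x, continuous h}.
  move=> pg gh; have /(_ x) gx := continuous_polyfun pg.
  by apply: near_eq_continuous gx; exact: near_ext.
split.
- exact: (diff_ext f).
- move=> v; apply: (diff_ext ('D_v f)); first exact: polyfun_derive.
  exact: derive_ext.
- move=> v w; apply: (cont_ext ('D_w ('D_v f))).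
    exact/polyfun_derive/polyfun_derive.
  exact/derive_ext/derive_ext.
Qed.

End PolynomialFunctions.

(** * Second derivatives along a line *)

Lemma derive_along_line {R : realType} {V : normedModType R} (f : V -> R)
    (x v : V) (p : {poly R}) :
  (\forall t \near (0 : R), f (t *: v + x) = p.[t]) ->
  \forall t \near (0 : R), 'D_v f (t *: v + x) = p^`().[t].
Proof.
move=> fp; have := near_join fp; apply: filterS => t ft.
have -> : 'D_v f (t *: v + x) = 'D_1 (fun s : R => f (s *: v + x)) t.
  rewrite /derive; set g1 := fun h => h^-1 *: _; set g2 := fun h => h^-1 *: _.
  suff -> : g1 = g2 by [].
  apply/funext => h; rewrite /g1 /g2 /=.
  by rewrite addrA -scalerDl [h *: 1]mulr1.
by rewrite (near_eq_derive _ ft) derive_val.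
Qed.

(** The diagonal of the Hessian only depends on f on a line segment, so it can
    be computed by formal differentiation of a one-variable polynomial, with no
    smoothness of f away from the line. *)
Lemma hessian_along_line {R : realType} {V : normedModType R} (f : V -> R)
    (x v : V) (p : {poly R}) :
  (\forall t \near (0 : R), f (t *: v + x) = p.[t]) ->
  hessian f x v v = p^`()^`().[0].
Proof.
move=> fp; have Dfp := @derive_along_line _ _ f x v p fp.
have DDfp := @derive_along_line _ _ ('D_v f) x v _ Dfp.
by have := nbhs_singleton DDfp; rewrite scale0r add0r.
Qed.

Lemma near_line {R : realType} {V : normedModType R} (U : set V) (x v : V) :
  nbhs x U -> \forall t \near (0 : R), U (t *: v + x).
Proof.
have : (t *: v + x) @[t --> (0 : R)] --> (0 : R) *: v + x.
  by apply: cvgD; [exact: scalel_continuous|exact: cvg_cst].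
by rewrite scale0r add0r; exact.
Qed.

(** * Euclidean inner product and quadratic forms *)

Section Inner.
Set Implicit Arguments.
Unset Strict Implicit.
Context {R : realType}.

Lemma mx_innerE m n (F G : 'M[R]_(m, n)) : mx_inner F G = \tr (F^T *m G).
Proof.
rewrite /mx_inner exchange_big; apply: eq_bigr => j _.
by rewrite mxE; apply: eq_bigr => i _; rewrite mxE.
Qed.

Lemma mx_inner_ge0 m n (F : 'M[R]_(m, n)) : 0 <= mx_inner F F.
Proof. by apply: sumr_ge0 => i _; apply: sumr_ge0 => j _; rewrite -expr2 sqr_ge0. Qed.

Lemma mx_inner_eq0 m n (F : 'M[R]_(m, n)) : mx_inner F F = 0 -> F = 0.
Proof.
move=> F0; apply/matrixP => i j; rewrite mxE; apply/eqP.
rewrite -[_ == 0]sqrf_eq0 eq_le sqr_ge0 andbT -F0 expr2.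
rewrite /mx_inner (bigD1 i)//= (bigD1 j)//= -addrA lerDl addr_ge0//.
  by apply: sumr_ge0 => l _; rewrite -expr2 sqr_ge0.
by apply: sumr_ge0 => k _; apply: sumr_ge0 => l _; rewrite -expr2 sqr_ge0.
Qed.

Lemma mx_inner0 m n : mx_inner (0 : 'M[R]_(m, n)) 0 = 0.
Proof. by rewrite mx_innerE mulmx0 mxtrace0. Qed.

Lemma mx_inner_isometry m n (P : 'M[R]_m) (F : 'M[R]_(m, n)) :
  P^T *m P = 1%:M -> mx_inner (P *m F) (P *m F) = mx_inner F F.
Proof.
by move=> PP; rewrite !mx_innerE trmx_mul mulmxA -(mulmxA F^T) PP mulmx1.
Qed.

Lemma mx_innerZ m n a (F : 'M[R]_(m, n)) :
  mx_inner (a *: F) (a *: F) = a ^+ 2 * mx_inner F F.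
Proof.
rewrite /mx_inner mulr_sumr; apply: eq_bigr => i _.
by rewrite mulr_sumr; apply: eq_bigr => j _; rewrite !mxE; ring.
Qed.

Lemma quadratic_form_line m n (Q : 'M[R]_(m, n) -> R) (S G : 'M[R]_(m, n)) :
  is_quadratic_form Q ->
  exists b, forall s t, Q (s *: S + t *: G) = s ^+ 2 * Q S + s * t * b + t ^+ 2 * Q G.
Proof.
move=> [B QB]; exists (2 * B S G) => s t; rewrite !QB.
rewrite linearDl !linearZl_LR !raddfD /= !linearZr_LR /=.
have -> : B G S = B S G by rewrite hermC /= expr0 mul1r.
by rewrite /GRing.scale /=; ring.
Qed.

Lemma affine_ge0 (a b : R) : (forall t, 0 <= a + t * b) -> b = 0.
Proof.
move=> H; apply/eqP; apply: contraT => b0.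
have := H (- (a + 1) / b); rewrite divfK//; lra.
Qed.

(** A nonnegative form has every null vector in its kernel: Q(S + t N) is affine
    in t when Q(N) = 0, so the mixed term vanishes. Apply this to
    2 M = (M + M^T) + (M - M^T). *)
Lemma quadratic_form_sym d (Q : 'M[R]_d -> R) (M : 'M[R]_d) :
  is_quadratic_form Q -> (forall M, 0 <= Q M) ->
  (forall M, antisymmetric_mx M -> Q M = 0) -> Q (M + M^T) = 4 * Q M.
Proof.
move=> Qq Q0 Qa.
have [b Qb] := quadratic_form_line (M + M^T) (M - M^T) Qq.
have aM : Q (M - M^T) = 0.
  by apply: Qa; rewrite /antisymmetric_mx linearB /= trmxK opprB.
have b0 : b = 0.
  apply: (@affine_ge0 (Q (M + M^T))) => t.
  have := Q0 (1 *: (M + M^T) + t *: (M - M^T)); rewrite Qb aM; lra.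
have [c Qc] := quadratic_form_line M M Qq.
have e : 1 *: (M + M^T) + 1 *: (M - M^T) = 2 *: M + 0 *: M.
  by rewrite !scale1r scale0r addr0 addrACA subrr addr0 scaler_nat mulr2n.
have := Qb 1 1; rewrite e Qc aM b0; lra.
Qed.

End Inner.

(** * The linear algebra of the cell *)

Section Cell.
Set Implicit Arguments.
Unset Strict Implicit.
Context {R : realType}.

(** Multiplication on the right subtracts from each column the mean column. *)
Definition centering n : 'M[R]_n := 1%:M - n%:R^-1 *: const_mx 1.

Lemma centering_id m n (F : 'M[R]_(m, n)) :
  (forall i, \sum_j F i j = 0) -> F *m centering n = F.
Proof.
move=> F0; rewrite mulmxBr mulmx1 -scalemxAr -[RHS]subr0; congr (_ - _).
rewrite (_ : F *m _ = 0) ?scaler0//; apply/matrixP => i j; rewrite !mxE -[RHS](F0 i).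
by apply: eq_bigr => k _; rewrite mxE mulr1.
Qed.

Lemma translation_mxE d n (b : 'cV[R]_d) :
  translation_mx n b = b *m const_mx 1.
Proof.
by apply/matrixP => i j; rewrite !mxE big_ord1 mxE mulr1.
Qed.

Lemma translation_centering m n (b : 'cV[R]_m) : (0 < n)%N ->
  translation_mx n b *m centering n = 0.
Proof.
move=> n0; apply/matrixP => i j; rewrite mulmxBr mulmx1 -scalemxAr !mxE.
under eq_bigr do rewrite !mxE mulr1.
rewrite sumr_const card_ord -[b i 0 *+ n]mulr_natr mulrCA mulVf ?mulr1 ?subrr//.
by rewrite pnatr_eq0 -lt0n.
Qed.

Lemma sub_centering m n (F : 'M[R]_(m, n)) :
  F - F *m centering n = translation_mx n (\col_i (n%:R^-1 * \sum_j F i j)).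
Proof.
apply/matrixP => i j; rewrite mulmxBr mulmx1 -scalemxAr opprB addrC subrK !mxE.
by congr (_ * _); apply: eq_bigr => k _; rewrite !mxE mulr1.
Qed.

Context {d : nat} {A : 'M[R]_d} {Z : 'M[R]_(d, 2 ^ d)}.
Hypothesis A_unit : A \in unitmx.
Hypothesis Z_cell : enumerates_cell A Z.

(** The cube is symmetric about the origin, so negating the columns permutes
    them and the sum equals its opposite. *)
Lemma cell_sum0 i : \sum_j Z i j = 0.
Proof.
have [Zinj Zrange] := Z_cell.
have opp j : exists k, col k Z == - col j Z.
  have : range (fun j => col j Z) (col j Z) by exists j.
  rewrite Zrange => -[e /= he Ae].
  have : range (fun j => col j Z) (- col j Z).
    rewrite Zrange; exists (- e); last by rewrite mulmxN Ae.
    by move=> l; rewrite mxE; have [->|->] := he l; [right; rewrite opprK|left].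
  by move=> [k _ kj]; exists k; apply/eqP.
pose s j := xchoose (opp j).
have sE j : col (s j) Z = - col j Z by apply/eqP/(xchooseP (opp j)).
have s_inj : injective s.
  by move=> j k jk; apply: Zinj; apply: oppr_inj; rewrite -!sE jk.
have : \sum_j Z i j = - \sum_j Z i j.
  rewrite {1}(reindex_inj s_inj) -sumrN; apply: eq_bigr => j _.
  by have /matrixP/(_ i 0) := sE j; rewrite !mxE.
lra.
Qed.

(** If u Z = 0 then u A is orthogonal to all vertices of the cube, hence to
    their differences, which contain the coordinate vectors. *)
Lemma cell_row_free : row_free Z.
Proof.
apply/inj_row_free => u uZ.
have [_ Zrange] := Z_cell.
have uA (e : 'cV[R]_d) : (forall i, e i 0 = - 2^-1 \/ e i 0 = 2^-1) ->
    u *m A *m e = 0.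
  move=> he; have : [set A *m e | e in [set e : 'cV[R]_d |
      forall i, e i 0 = - 2^-1 \/ e i 0 = 2^-1]] (A *m e) by exists e.
  rewrite -Zrange => -[j _ je].
  by rewrite -mulmxA -je colE mulmxA uZ mul0mx.
suff uA0 : u *m A = 0 by rewrite -(mulmxK A_unit u) uA0 mul0mx.
apply/rowP => i; rewrite [RHS]mxE.
pose e (b : R) : 'cV[R]_d := \col_k (if k == i then b else 2^-1).
have : u *m A *m (e 2^-1 - e (- 2^-1)) = 0.
  rewrite mulmxBr !uA ?subr0// => k; rewrite mxE; case: eqP => _; by [left|right].
move=> /matrixP/(_ 0 0); rewrite !mxE (bigD1 i)//= big1 ?addr0.
  rewrite !mxE eqxx opprK => h; rewrite -[LHS]mulr1; move: h; lra.
by move=> k /negPf ki; rewrite !mxE ki subrr mulr0.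
Qed.

(** Y recovers the affine part of a deformation. Precomposing any right inverse
    with centering makes it insensitive to translations, at no cost since Z is
    centred. *)
Lemma cell_right_inverse : exists Y : 'M[R]_(2 ^ d, d),
  Z *m Y = 1%:M /\ forall b : 'cV[R]_d, translation_mx (2 ^ d) b *m Y = 0.
Proof.
have /row_freeP[Y ZY] := cell_row_free.
exists (centering (2 ^ d) *m Y).
by split=> [|b]; rewrite mulmxA ?translation_centering ?mul0mx ?expn_gt0//
  centering_id//; exact: cell_sum0.
Qed.

End Cell.

(** * The cell energy *)

Section Energy.
Set Implicit Arguments.
Unset Strict Implicit.
Context {R : realType} {d n : nat}.
Variables (Z : 'M[R]_(d, n)) (Y : 'M[R]_(n, d)) (a p : R) (Q : 'M[R]_d -> R).

(** Multiplication on the right extracts from a deformation what is neither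
    affine nor a translation. *)
Definition nonaffine : 'M[R]_n := centering n - Y *m Z.

Definition well_energy (F : 'M[R]_(d, n)) : R :=
  a * Q ((F *m Y)^T *m (F *m Y) - 1%:M)
  + mx_inner (F *m nonaffine) (F *m nonaffine).

(** The three conditions serve, respectively, to exclude reflections from the
    zero set, to bound the growth term |F C|^p, and to keep the energy bounded. *)
Definition well : set 'M[R]_(d, n) := [set F |
  [/\ 0 < \det (F *m Y),
      mx_inner (F *m centering n) (F *m centering n) < mx_inner Z Z + 1 &
      well_energy F < 1]].

Definition cell_energy (F : 'M[R]_(d, n)) : R :=
  if `[< well F >] then well_energy F
  else 1 + mx_enorm (F *m centering n) `^ p.

Hypothesis n_gt0 : (0 < n)%N.
Hypothesis Z_sum0 : forall i, \sum_j Z i j = 0.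
Hypothesis ZY : Z *m Y = 1%:M.
Hypothesis translationY : forall b : 'cV[R]_d, translation_mx n b *m Y = 0.
Hypothesis a_gt0 : 0 < a.
Hypothesis Q_quad : is_quadratic_form Q.
Hypothesis Q_psd : forall M, 0 <= Q M.
Hypothesis Q_sym : forall M, M^T = M -> M != 0 -> 0 < Q M.
Hypothesis Q_antisym : forall M, antisymmetric_mx M -> Q M = 0.

Let Z_centered : Z *m centering n = Z.
Proof. exact: centering_id. Qed.

Lemma nonaffineZ : Z *m nonaffine = 0.
Proof. by rewrite mulmxBr Z_centered mulmxA ZY mul1mx subrr. Qed.

Lemma quadratic_form0 : Q 0 = 0.
Proof. by apply: Q_antisym; rewrite /antisymmetric_mx trmx0 oppr0. Qed.

Lemma well_energy_ge0 F : 0 <= well_energy F.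
Proof. by rewrite addr_ge0 ?mx_inner_ge0// mulr_ge0// ltW. Qed.

Lemma cell_energy_ge0 F : 0 <= cell_energy F.
Proof.
rewrite /cell_energy; case: ifP => _; first exact: well_energy_ge0.
by rewrite addr_ge0// powR_ge0.
Qed.

Lemma rigid_mulY (F : 'M[R]_(d, n)) (P : 'M[R]_d) b :
  (P *m F + translation_mx n b) *m Y = P *m (F *m Y).
Proof. by rewrite mulmxDl translationY addr0 mulmxA. Qed.

Lemma rigid_mulC (F : 'M[R]_(d, n)) (P : 'M[R]_d) b :
  (P *m F + translation_mx n b) *m centering n = P *m (F *m centering n).
Proof. by rewrite mulmxDl translation_centering// addr0 mulmxA. Qed.

Lemma rigid_mulT (F : 'M[R]_(d, n)) (P : 'M[R]_d) b :
  (P *m F + translation_mx n b) *m nonaffine = P *m (F *m nonaffine).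
Proof.
rewrite /nonaffine [LHS]mulmxBr rigid_mulC (mulmxA _ Y) rigid_mulY.
by rewrite !mulmxBr !mulmxA.
Qed.

Lemma well_energy_rigid F (P : 'M[R]_d) b : SO P ->
  well_energy (P *m F + translation_mx n b) = well_energy F.
Proof.
move=> [PP _]; rewrite /well_energy rigid_mulY rigid_mulT mx_inner_isometry//.
by rewrite trmx_mul mulmxA -(mulmxA _ P^T) PP mulmx1.
Qed.

Lemma well_rigid F (P : 'M[R]_d) b : SO P -> well (P *m F + translation_mx n b) <-> well F.
Proof.
move=> SP; have [PP detP] := SP.
rewrite /well /= rigid_mulY rigid_mulC mx_inner_isometry// det_mulmx detP mul1r.
by rewrite well_energy_rigid.
Qed.

Lemma cell_energy_rigid F (P : 'M[R]_d) b : SO P ->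
  cell_energy (P *m F + translation_mx n b) = cell_energy F.
Proof.
move=> SP; have [PP _] := SP.
rewrite /cell_energy (asbool_equiv_eq (well_rigid F b SP)).
by rewrite (well_energy_rigid F b SP) rigid_mulC /mx_enorm mx_inner_isometry.
Qed.

Lemma well_energyZ : well_energy Z = 0.
Proof.
rewrite /well_energy nonaffineZ ZY trmx1 mulmx1 subrr quadratic_form0 mulr0 add0r.
exact: mx_inner0.
Qed.

Lemma wellZ : well Z.
Proof.
split; first by rewrite ZY det1.
- by rewrite Z_centered ltrDl.
- by rewrite well_energyZ.
Qed.

Lemma decomposition (F : 'M[R]_(d, n)) :
  exists b, F = F *m Y *m Z + F *m nonaffine + translation_mx n b.
Proof.
exists (\col_i (n%:R^-1 * \sum_j F i j)).
rewrite -sub_centering /nonaffine mulmxBr mulmxA.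
by rewrite (addrC (_ *m Z)) subrK addrC subrK.
Qed.

(** Outside the well the energy is at least 1. Inside, a zero has both terms
    zero: the strain is symmetric, so Q detects it, and the affine part is
    orthogonal with positive determinant. *)
Lemma cell_energy_eq0 F : cell_energy F = 0 <->
  exists (P : 'M[R]_d) (b : 'cV[R]_d), SO P /\ F = P *m Z + translation_mx n b.
Proof.
split=> [|[P [b [SP ->]]]]; last first.
  by rewrite cell_energy_rigid// /cell_energy asboolT ?well_energyZ//; exact: wellZ.
rewrite /cell_energy; case: asboolP => [[detF _ _]|_ E0]; last first.
  by have := powR_ge0 (mx_enorm (F *m centering n)) p; lra.
have aQ0 : 0 <= a * Q ((F *m Y)^T *m (F *m Y) - 1%:M).
  by rewrite mulr_ge0// ltW.
move=> /eqP; rewrite /well_energy paddr_eq0 ?mx_inner_ge0//.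
rewrite mulf_eq0 gt_eqF//= => /andP[/eqP QF /eqP /mx_inner_eq0 FT].
have [b ->] := decomposition F; rewrite FT addr0.
exists (F *m Y), b; split=> //.
have FF : (F *m Y)^T *m (F *m Y) = 1%:M.
  apply/eqP; rewrite -subr_eq0; apply: contraT => /Q_sym; rewrite QF ltxx; apply.
  by rewrite linearB/= trmx_mul trmxK trmx1.
split=> //; have /(congr1 determinant) := FF.
rewrite det_mulmx det_tr det1 -expr2 => /eqP; rewrite sqrf_eq1 => /orP[/eqP//|/eqP e].
by move: detF; rewrite e; lra.
Qed.

Lemma cell_energy_growth (F : 'M[R]_(d, n)) : 0 <= p -> (forall i, \sum_j F i j = 0) ->
  mx_enorm F `^ p - ((mx_inner Z Z + 1) `^ p + 1) <= cell_energy F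
    <= mx_enorm F `^ p + 1.
Proof.
move=> p0 F0; rewrite /cell_energy centering_id//.
have np := powR_ge0 (mx_enorm F) p.
have kp := powR_ge0 (mx_inner Z Z + 1) p.
case: asboolP => [[_ + wF1]|_]; last by apply/andP; split; lra.
rewrite centering_id// => FK; have wF0 := well_energy_ge0 F.
have Z0 := mx_inner_ge0 Z.
have : mx_enorm F `^ p <= (mx_inner Z Z + 1) `^ p.
  apply: ge0_ler_powR; rewrite ?nnegrE ?sqrtr_ge0//; first by lra.
  rewrite -[leRHS]ger0_norm; last by lra.
  rewrite -sqrtr_sqr ler_wsqrtr//; nra.
by move=> ?; apply/andP; split; lra.
Qed.

Lemma polyfun_well_energy : polyfun well_energy.
Proof.
have pM r (M : 'M[R]_(n, r)) : polyfun_mx (fun F : 'M[R]_(d, n) => F *m M).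
  by apply: polyfun_mulmx; [exact: polyfun_mx_id|exact: polyfun_mx_cst].
apply: polyfunD; last exact: polyfun_inner.
apply: polyfunM; first exact: polyfun_cst.
apply: polyfun_quadratic => //; apply: polyfun_mxB; last exact: polyfun_mx_cst.
by apply: polyfun_mulmx => //; exact: polyfun_trmx.
Qed.

Lemma open_well : open well.
Proof.
have pM r (M : 'M[R]_(n, r)) : polyfun_mx (fun F : 'M[R]_(d, n) => F *m M).
  by apply: polyfun_mulmx; [exact: polyfun_mx_id|exact: polyfun_mx_cst].
have -> : well = (fun F => \det (F *m Y)) @^-1` [set x | 0 < x] `&`
    (fun F => mx_inner (F *m centering n) (F *m centering n)) @^-1`
       [set x | x < mx_inner Z Z + 1] `&`
    well_energy @^-1` [set x | x < 1].
  by apply/seteqP; split=> F /=; [case|case=> -[]].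
apply: openI; first apply: openI; apply: open_comp => [F _|];
  rewrite ?gt_open ?lt_open//; apply: continuous_polyfun.
- exact: polyfun_det.
- exact: polyfun_inner.
- exact: polyfun_well_energy.
Qed.

Lemma C2_cell_energy : C2_on well cell_energy.
Proof.
apply: C2_polyfun polyfun_well_energy open_well _ => F; rewrite inE => wF.
by rewrite /cell_energy asboolT.
Qed.

(** The strain of 1 + t M is t (M + M^T) + t^2 M^T M, so the expansion starts at
    order two and its leading coefficient is explicit. *)
Lemma well_energy_line (H : 'M[R]_(d, n)) : exists q : {poly R},
  forall t, well_energy (t *: H + Z) =
   ((4 * a * Q (H *m Y) + mx_inner (H *m nonaffine) (H *m nonaffine))%:P * 'X^2
    + 'X^3 * q).[t].
Proof.
set M := H *m Y.
have [b Qb] := quadratic_form_line (M + M^T) (M^T *m M) Q_quad.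
exists ((a * b)%:P + (a * Q (M^T *m M))%:P * 'X) => t.
rewrite /well_energy !mulmxDl nonaffineZ addr0 ZY -!scalemxAl -/M mx_innerZ.
have -> : (t *: M + 1%:M)^T *m (t *: M + 1%:M) - 1%:M
    = t *: (M + M^T) + t ^+ 2 *: (M^T *m M).
  have -> : (t *: M + 1%:M)^T = t *: M^T + 1%:M.
    by apply/matrixP => i j; rewrite !mxE [j == i]eq_sym.
  rewrite mulmxDl !mulmxDr mul1mx !mulmx1.
  rewrite -!scalemxAl -!scalemxAr scalerA scalerDr.
  by rewrite addrA addrK addrC addrAC expr2 -addrA addrC.
rewrite Qb quadratic_form_sym// !(hornerD, hornerM, hornerXn, hornerX, hornerC); ring.
Qed.

(** Stated for any f that restricts on a line to a multiple of the cell energy,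
    so that it covers both the cell energy itself and the Cauchy-Born energy,
    which lives on a different space. *)
Lemma hessian_cell_energy {V : normedModType R} (f : V -> R) (x v : V) k
    (H : 'M[R]_(d, n)) :
  (forall t : R, f (t *: v + x) = k * cell_energy (t *: H + Z)) ->
  hessian f x v v =
   2 * k * (4 * a * Q (H *m Y) + mx_inner (H *m nonaffine) (H *m nonaffine)).
Proof.
move=> fE; have [q qE] := well_energy_line H.
rewrite (@hessian_along_line _ _ f x v (k%:P *
   ((4 * a * Q (H *m Y) + mx_inner (H *m nonaffine) (H *m nonaffine))%:P * 'X^2
    + 'X^3 * q))).
  rewrite horner_coef0 !coef_deriv coefCM coefD coefCM coefXn coefXnM /=.
  ring.
have near_well : \forall t \near (0 : R), well (t *: H + Z).
  by apply: near_line; exact: (open_nbhs_nbhs (conj open_well wellZ)).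
apply: filterS near_well => t wt.
by rewrite fE hornerM hornerC -qE /cell_energy asboolT.
Qed.

(** A direction with vanishing second derivative is itself an infinitesimal
    rigid motion, hence orthogonal to itself. *)
Lemma hessian_pos F :
  orthogonal_complement (infinitesimal_rigid_motions Z) F -> F != 0 ->
  0 < hessian cell_energy Z F F.
Proof.
move=> Fperp F0.
rewrite (@hessian_cell_energy _ cell_energy Z F 1 F); last by move=> t; rewrite mul1r.
have Q0 := Q_psd (F *m Y); have T0 := mx_inner_ge0 (F *m nonaffine).
suff : 4 * a * Q (F *m Y) + mx_inner (F *m nonaffine) (F *m nonaffine) != 0.
  have : 0 <= 4 * a * Q (F *m Y) by rewrite !mulr_ge0// ltW.
  move=> ? ?; rewrite mulr1 mulr_gt0// lt_def addr_ge0// andbT//.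
apply: contra F0; rewrite paddr_eq0 ?mulr_ge0// ?(ltW a_gt0)//.
rewrite !mulf_eq0 pnatr_eq0 (gt_eqF a_gt0)/= => /andP[/eqP QF /eqP/mx_inner_eq0 FT].
apply/eqP/mx_inner_eq0/Fperp.
have [b {1}->] := decomposition F; rewrite FT addr0.
exists b, (F *m Y); split; last by rewrite addrC.
apply/eqP; rewrite -addr_eq0 addrC; apply: contraT => /Q_sym.
by rewrite quadratic_form_sym// QF mulr0 ltxx; apply; rewrite linearD/= trmxK addrC.
Qed.

End Energy.

Theorem proposition1p10 (R : realType) (d : nat) (d_gt0 : (0 < d)%N)
    (A : 'M[R]_d) (A_unit : A \in unitmx)
    (Z : 'M[R]_(d, 2 ^ d)) (Z_cell : enumerates_cell A Z)
    (p : R) (p_gt1 : 1 < p) (p_ge_d : d%:R <= p)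
    (Q : 'M[R]_d -> R) (Q_quad : is_quadratic_form Q)
    (Q_psd : forall M, 0 <= Q M)
    (Q_sym : forall M, M^T = M -> M != 0 -> 0 < Q M)
    (Q_antisym : forall M, antisymmetric_mx M -> Q M = 0) :
  exists W : 'M[R]_(d, 2 ^ d) -> R,
    (forall F, 0 <= W F) /\
    (* (a) *)
    (exists c c' c'' : R,
       [/\ 0 < c, 0 < c', 0 < c'' &
           forall F, V0 F ->
             c * mx_enorm F `^ p - c' <= W F <= c'' * (mx_enorm F `^ p + 1)]) /\
    (* (b) *)
    (forall (F : 'M[R]_(d, 2 ^ d)) (P : 'M[R]_d) (b : 'cV[R]_d), SO P ->
       W (P *m F + translation_mx (2 ^ d) b) = W F) /\
    (* (c) *)
    (forall F, (forall G, W F <= W G) <-> W F = 0) /\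
    (forall F, W F = 0 <->
       exists (P : 'M[R]_d) (b : 'cV[R]_d),
         SO P /\ F = P *m Z + translation_mx (2 ^ d) b) /\
    (* (d) *)
    (exists U : set 'M[R]_(d, 2 ^ d),
       [/\ open U, forall P : 'M[R]_d, SO P -> U (P *m Z) & C2_on U W]) /\
    (forall F,
       orthogonal_complement (infinitesimal_rigid_motions Z) F -> F != 0 ->
       0 < hessian W Z F F) /\
    (forall M : 'M[R]_d, 2^-1 * hessian (W_CB A Z W) 1%:M M M = Q M).
Proof.
have Z_sum0 := cell_sum0 Z_cell.
have [Y [ZY tY]] := cell_right_inverse A_unit Z_cell.
have n_gt0 : (0 < 2 ^ d)%N by rewrite expn_gt0.
have detA : 0 < `|\det A| by rewrite normr_gt0 -unitfE -unitmxE.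
(* The factor 1/4 compensates Q (M + M^T) = 4 Q M, where M + M^T is the
   linearization of the strain at the identity. *)
pose a := `|\det A| / 4.
have a_gt0 : 0 < a by rewrite divr_gt0.
pose W := cell_energy Z Y a p Q.
have W_ge0 F : 0 <= W F by exact: cell_energy_ge0.
have W_eq0 F : W F = 0 <-> exists (P : 'M[R]_d) (b : 'cV[R]_d),
    SO P /\ F = P *m Z + translation_mx (2 ^ d) b by exact: cell_energy_eq0.
exists W; split; first exact: W_ge0.
split; [|split; [|split; [|split; [|split; [|split]]]]].
- exists 1, ((mx_inner Z Z + 1) `^ p + 1), 1; split=> //.
    by rewrite ltr_wpDl// powR_ge0.
  move=> F VF; rewrite !mul1r; apply: cell_energy_growth => //; lra.
- by move=> F P b; exact: cell_energy_rigid.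
- move=> F; split=> [Fmin|-> //].
  apply/eqP; rewrite eq_le W_ge0 andbT.
  have WZ : W (1%:M *m Z + translation_mx (2 ^ d) 0) = 0.
    apply/W_eq0; exists 1%:M, 0; split=> //.
    by split; rewrite ?trmx1 ?mulmx1 ?det1.
  by rewrite -WZ.
- exact: W_eq0.
- exists (well Z Y a Q); split; [exact: open_well| |exact: C2_cell_energy].
  move=> P SP; have -> : P *m Z = P *m Z + translation_mx (2 ^ d) 0.
    by rewrite translation_mxE mul0mx addr0.
  by apply/well_rigid => //; exact: wellZ.
- by move=> F; exact: hessian_pos.
- move=> M.
  have WE (t : R) : W_CB A Z W (t *: M + 1%:M) =
      `|\det A|^-1 * cell_energy Z Y a p Q (t *: (M *m Z) + Z).
    by rewrite /W_CB mulmxDl mul1mx -scalemxAl.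
  rewrite (hessian_cell_energy Z_sum0 ZY Q_quad Q_psd Q_antisym WE).
  have -> : M *m Z *m Y = M by rewrite -mulmxA ZY mulmx1.
  have -> : M *m Z *m nonaffine Z Y = 0.
    by rewrite -mulmxA (nonaffineZ Z_sum0 ZY) mulmx0.
  rewrite mx_inner0 /a; field; rewrite gt_eqF//.
Qed.
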